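(* Let $\gamma:\mathbb{P}^2_{\mathbb{C}}\to\mathbb{P}^2_{\mathbb{C}}$ be a finite-order automorphism. Then there exists a projective change of coordinates $\psi:\mathbb{P}^2_{\mathbb{C}}\to\mathbb{P}^2_{\mathbb{C}}$ such that $\gamma=\psi\circ\sigma\circ\psi^{-1}$, where $\sigma([u:v:w])=[e^{i\theta_u}u:e^{i\theta_v}v:w]$ for some $\theta_u,\theta_v\in\mathbb{R}$.
   Context: Automorphisms of $\mathbb{P}^2_{\mathbb{C}}$ are the elements of $\operatorname{PGL}(3,\mathbb{C})$; a projective change of coordinates is a map of $\mathbb{P}^2_{\mathbb{C}}$ induced by an element of $\operatorname{GL}(3,\mathbb{C})$. *)

(* Defs.v *)
From HB Require Import structures.
From mathcomp Require Import all_boot all_order all_algebra.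
From mathcomp Require Import generic_quotient.
From mathcomp Require Import all_classical all_reals all_analysis.
From mathcomp Require Import complex.

Set Implicit Arguments.
Unset Strict Implicit.
Unset Printing Implicit Defensive.

Import GRing.Theory Num.Theory.
Local Open Scope ring_scope.
Local Open Scope quotient_scope.

Section ProjectivePlane.
Variable F : fieldType.

Definition nzvec := {x : 'cV[F]_3 | x != 0}.

Definition proportional : rel nzvec :=
  fun x y => `[< exists2 c : F, c != 0 & val y = c *: val x >].

Lemma proportional_refl : reflexive proportional.
Proof. by move=> x; apply/asboolP; exists 1; rewrite ?oner_neq0 ?scale1r. Qed.

Lemma proportional_symW x y : proportional x y -> proportional y x.
Proof.
move=> /asboolP[c c0 yE]; apply/asboolP; exists c^-1; first by rewrite invr_eq0.
by rewrite yE scalerA mulVf ?scale1r.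
Qed.

Lemma proportional_sym : symmetric proportional.
Proof. by move=> x y; apply/idP/idP; exact: proportional_symW. Qed.

Lemma proportional_trans : transitive proportional.
Proof.
move=> y x z /asboolP[c c0 yE] /asboolP[d d0 zE]; apply/asboolP.
by exists (d * c); rewrite ?mulf_neq0 // zE yE scalerA.
Qed.

Canonical proportional_equiv :=
  EquivRel proportional proportional_refl proportional_sym proportional_trans.

Definition P2 := {eq_quot proportional_equiv}.

Definition class_of (x : nzvec) : P2 := \pi_(P2) x.

Definition col3 (u v w : F) : 'cV[F]_3 := \col_i [:: u; v; w]`_i.

(* The point [u : v : w]. *)
Definition hpoint (u v w : F) (nz : col3 u v w != 0) : P2 :=
  class_of (exist _ (col3 u v w) nz).

Lemma mulmx_neq0 (A : 'M[F]_3) (x : 'cV[F]_3) :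
  A \in unitmx -> x != 0 -> A *m x != 0.
Proof. by move=> Au; apply: contra_neq => Ax0; rewrite -(mulKmx Au x) Ax0 mulmx0. Qed.

Definition GLact (A : 'M[F]_3) (Au : A \in unitmx) (x : nzvec) : nzvec :=
  exist _ (A *m val x) (mulmx_neq0 Au (valP x)).

Definition proj_map (A : 'M[F]_3) (Au : A \in unitmx) (p : P2) : P2 :=
  class_of (GLact Au (repr p)).

Lemma proj_mapE (A : 'M[F]_3) (Au : A \in unitmx) (x : nzvec) :
  proj_map Au (class_of x) = class_of (GLact Au x).
Proof.
apply/eqmodP => /=; apply/asboolP.
have /eqmodP/asboolP[c c0 xE] : repr (class_of x) = x %[mod P2].
  by rewrite reprK.
by exists c => //=; rewrite xE scalemxAr.
Qed.

Lemma proj_map_eqP (A B : 'M[F]_3) (Au : A \in unitmx) (Bu : B \in unitmx) :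
  proj_map Au = proj_map Bu <-> exists2 c : F, c != 0 & B = c *: A.
Proof.
split; last first.
  move=> [c c0 BE]; apply/funext => p; apply/eqmodP/asboolP; exists c => //=.
  by rewrite BE scalemxAl.
move=> AB.
pose M := invmx A *m B.
have Mx (x : 'cV[F]_3) : x != 0 -> exists2 c : F, c != 0 & M *m x = c *: x.
  move=> x0; have := congr1 (@^~ (class_of (exist _ x x0 : nzvec))) AB.
  rewrite /= !proj_mapE => /eqmodP/asboolP[c c0 /= E].
  by exists c => //; rewrite /M -mulmxA E -scalemxAr mulKmx.
pose e (i : 'I_3) : 'cV[F]_3 := delta_mx i 0.
have e0 i : e i != 0.
  by apply/eqP => /matrixP/(_ i 0)/eqP; rewrite !mxE !eqxx oner_eq0.
have s0 : const_mx 1 != 0 :> 'cV[F]_3.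
  by apply/eqP => /matrixP/(_ 0 0)/eqP; rewrite !mxE oner_eq0.
have [c c0 cE] := Mx _ s0.
exists c => //.
suff ME : M = c%:M by rewrite -(mulKVmx Au B) -/M ME mul_mx_scalar.
have off i j : i != j -> M i j = 0.
  move=> ij; have [d _ /matrixP/(_ i 0)] := Mx _ (e0 j).
  by rewrite -colE !mxE (negbTE ij) /= mulr0.
apply/matrixP => i j; rewrite [RHS]mxE; case: (eqVneq i j) => [->|/off//].
have /matrixP/(_ j 0) := cE; rewrite mxE [RHS]mxE [const_mx _ _ _]mxE mulr1.
move=> <-; rewrite mulr1n (bigD1 j) //= big1 ?addr0.
  by rewrite [const_mx _ _ _]mxE mulr1.
by move=> k kj; rewrite off ?mul0r // eq_sym.
Qed.

(* By [proj_map_eqP] these self-maps of P2 are exactly the elements of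
   PGL(3, F), with composition as group law. *)
Definition is_automorphism (f : P2 -> P2) : Prop :=
  exists (A : 'M[F]_3) (Au : A \in unitmx), f = proj_map Au.

Definition finite_order (f : P2 -> P2) : Prop :=
  exists2 n : nat, (0 < n)%N & iter n f = id.

End ProjectivePlane.

Section Rotation.
Variable R : realType.
Local Notation C := (complex R).

(* e^{i t} *)
Definition expi (t : R) : C := Complex (cos t) (sin t).

Lemma expi_neq0 t : expi t != 0.
Proof.
apply/eqP => -[c0 s0]; have := cos2Dsin2 t.
by rewrite c0 s0 expr0n addr0 => /esym/eqP; rewrite oner_eq0.
Qed.

Definition rotation_mx (tu tv : R) : 'M[C]_3 :=
  diag_mx (\row_i [:: expi tu; expi tv; 1]`_i).

Lemma rotation_mx_unit tu tv : rotation_mx tu tv \in unitmx.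
Proof.
rewrite unitmxE det_diag unitfE; apply/prodf_neq0 => i _; rewrite mxE.
by case: i => [[|[|[|//]]]] /= _; rewrite ?expi_neq0 ?oner_neq0.
Qed.

Definition rotation (tu tv : R) : P2 C -> P2 C :=
  proj_map (rotation_mx_unit tu tv).

Lemma rotation_mxE tu tv u v w :
  rotation_mx tu tv *m col3 u v w = col3 (expi tu * u) (expi tv * v) w.
Proof.
apply/matrixP => i j; rewrite mul_diag_mx !mxE.
by case: i => [[|[|[|//]]]] /= _; rewrite ?mul1r.
Qed.

Lemma rotation_neq0 tu tv u v w :
  col3 u v w != 0 -> col3 (expi tu * u) (expi tv * v) w != 0.
Proof. by rewrite -rotation_mxE; apply/mulmx_neq0/rotation_mx_unit. Qed.

Lemma rotationE tu tv u v w (nz : col3 u v w != 0) :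
  rotation tu tv (hpoint nz) = hpoint (rotation_neq0 tu tv nz).
Proof.
rewrite /rotation /hpoint proj_mapE; congr class_of.
by apply: val_inj; rewrite /= rotation_mxE.
Qed.

End Rotation.

(* Main.v *)
(** By [proj_map_eqP], a matrix A representing an automorphism of finite order n
    satisfies A^n = c I with c != 0.  Its minimal polynomial divides X^n - c,
    which is separable, so A is diagonalizable; its eigenvalues all have n-th
    power c, so their ratios are roots of unity and hence of the form e^{it}.
    Dividing the diagonal form by its last entry yields the rotation. *)
Require Import Defs.
From mathcomp Require Import all_boot all_order all_algebra.
From mathcomp Require Import all_classical all_reals all_analysis.
From mathcomp Require Import complex.
From mathcomp Require Import generic_quotient separable mxred lra.

Set Implicit Arguments.
Unset Strict Implicit.
Unset Printing Implicit Defensive.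

Import Order.TTheory GRing.Theory Num.Theory.
Local Open Scope ring_scope.
Local Open Scope quotient_scope.

Section ProjMap.
Variable F : fieldType.
Implicit Types A B : 'M[F]_3.

Lemma class_of_surj (p : P2 F) : exists x : nzvec F, p = class_of x.
Proof. by exists (repr p); rewrite /class_of reprK. Qed.

Lemma unitmx_mulW A B : A \in unitmx -> B \in unitmx -> A *m B \in unitmx.
Proof. by move=> Au Bu; rewrite unitmx_mul Au. Qed.

Lemma proj_map_comp A B (Au : A \in unitmx) (Bu : B \in unitmx) :
  proj_map Au \o proj_map Bu = proj_map (unitmx_mulW Au Bu).
Proof.
apply/funext => p; have [x ->] := class_of_surj p.
by rewrite /= !proj_mapE; congr class_of; apply: val_inj; rewrite /= mulmxA.
Qed.

(** The invertibility proof depends on the matrix, so rewriting a matrix under [proj_map] is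
    replaced by this transport, the case of scalar 1 in [proj_map_eqP]. *)
Lemma eq_proj_map A B (Au : A \in unitmx) (Bu : B \in unitmx) :
  A = B -> proj_map Au = proj_map Bu.
Proof.
by move=> AB; apply/proj_map_eqP; exists 1; rewrite ?oner_neq0 ?scale1r.
Qed.

Lemma proj_map1 (u : (1%:M : 'M[F]_3) \in unitmx) : proj_map u = id.
Proof.
apply/funext => p; have [x ->] := class_of_surj p.
by rewrite proj_mapE; congr class_of; apply: val_inj; rewrite /= mul1mx.
Qed.

Lemma iter_proj_map A (Au : A \in unitmx) n :
  exists u : A ^+ n \in unitmx, iter n (proj_map Au) = proj_map u.
Proof.
elim: n => [|n [u IH]]; first by exists (unitmx1 _ _); rewrite proj_map1.
have u' : A ^+ n.+1 \in unitmx by rewrite exprS; exact: unitmx_mulW.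
exists u'; rewrite (_ : iter n.+1 _ = proj_map Au \o iter n (proj_map Au))//.
by rewrite IH proj_map_comp; apply: eq_proj_map; rewrite exprS.
Qed.

Lemma proj_map_invK A (Au : A \in unitmx) (Vu : invmx A \in unitmx) :
  cancel (proj_map Au) (proj_map Vu) /\ cancel (proj_map Vu) (proj_map Au).
Proof.
split=> p.
- rewrite -[LHS]/((proj_map Vu \o proj_map Au) p) proj_map_comp.
  by rewrite (eq_proj_map _ (unitmx1 _ _)) ?mulVmx// proj_map1.
- rewrite -[LHS]/((proj_map Au \o proj_map Vu) p) proj_map_comp.
  by rewrite (eq_proj_map _ (unitmx1 _ _)) ?mulmxV// proj_map1.
Qed.

End ProjMap.

Section Diagonalization.
Variable F : closedFieldType.

(** A common root x of the polynomial and its derivative would satisfy n x^(n-1) = 0, hence x = 0,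
    contradicting x^n = c. *)
Lemma separable_Xn_subC n (c : F) :
  n%:R != 0 :> F -> c != 0 -> separable_poly ('X^n - c%:P).
Proof.
move=> n0 c0; have n_gt0 : (0 < n)%N by case: (n) n0 => //; rewrite eqxx.
rewrite separable_poly.unlock.
apply/Pdiv.ClosedField.coprimepP => x.
rewrite rootE !hornerE subr_eq0 => /eqP xn.
rewrite derivB derivC subr0 derivXn hornerMn hornerXn -mulr_natl mulf_neq0//.
apply: expf_neq0; apply: contraNneq c0 => x0.
by rewrite -xn x0 expr0n gtn_eqF.
Qed.

Lemma diagonalizable_expr_scalar n m (c : F) (A : 'M[F]_m.+1) :
  n%:R != 0 :> F -> c != 0 -> A ^+ n = c%:M ->
  exists (P : 'M[F]_m.+1) (d : 'rV[F]_m.+1),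
    [/\ P \in unitmx, A = invmx P *m diag_mx d *m P & forall i, d 0 i ^+ n = c].
Proof.
move=> n0 c0 An.
have n_gt0 : (0 < n)%N by case: (n) n0 => //; rewrite eqxx.
pose p : {poly F} := 'X^n - c%:P.
have pA0 : horner_mx A p = 0.
  by rewrite rmorphB rmorphXn /= horner_mx_X horner_mx_C An subrr.
(* Over a closed field [p] splits into linear factors; separability makes the roots [rs] distinct,
   as the diagonalizability criterion demands. *)
have [rs] := closed_field_poly_normal p.
rewrite (monicP (monicXnsubC _ n_gt0)) scale1r => rsE.
have /diagonalizableP [P Pu /(similar_diagLR Pu)[d]] :
    exists2 rs : seq F, uniq rs & mxminpoly A %| \prod_(x <- rs) ('X - x%:P).
  exists rs; first by rewrite -separable_prod_XsubC -rsE separable_Xn_subC.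
  by rewrite -rsE; exact: mxminpoly_min.
rewrite conjVmx // => AE.
exists P, d; split => // i.
(* Conjugating p(A) = 0 by [P] gives p(D) = 0 for the diagonal form D; its i-th diagonal entry is
   d_i^n - c. *)
have : horner_mx (diag_mx d) p = 0.
  have -> : diag_mx d = P *m A *m invmx P.
    by rewrite AE !mulmxA mulmxV// mul1mx mulmxK.
  by rewrite horner_mx_uconj// pA0 mulmx0 mul0mx.
rewrite horner_mx_diag => /matrixP/(_ i i).
by rewrite !mxE eqxx mulr1n !hornerE => /eqP; rewrite subr_eq0 => /eqP.
Qed.

End Diagonalization.

Section UnitCircle.
Variable R : realType.
Local Notation C := (complex R).

(** The angle is [acos x] up to sign: its cosine is x and its sine is |y|, so the sign of y decides
    between [acos x] and [- acos x]. *)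
Lemma expi_surj (z : C) : `|z| = 1 -> exists t, z = expi t.
Proof.
case: z => x y z1.
have xy1 : x ^+ 2 + y ^+ 2 = 1.
  by have := sqr_normc (Complex x y); rewrite z1 expr1n /= => -[]; lra.
have x_bnd : -1 <= x <= 1.
  by apply/andP; split; nra.
have cosx : cos (acos x) = x by rewrite acosK.
have sinx : sin (acos x) = `|y|.
  by rewrite sin_acos// -xy1 [_ + y ^+ 2]addrC addrK sqrtr_sqr.
case: (ger0P y) sinx => _ sinx.
- by exists (acos x); rewrite /expi cosx sinx.
- by exists (- acos x); rewrite /expi cosN sinN cosx sinx opprK.
Qed.

(** Taking norms gives |z|^n = 1 with |z| nonnegative, which forces |z| = 1. *)
Lemma unity_root_expi n (z : C) : (0 < n)%N -> z ^+ n = 1 -> exists t, z = expi t.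
Proof.
move=> n0 zn; apply: expi_surj; apply/eqP.
by rewrite -(pexpr_eq1 n0)// -normrX zn normr1.
Qed.

End UnitCircle.

Theorem proposition3p17 (R : realType)
    (gamma : P2 (complex R) -> P2 (complex R)) :
  is_automorphism gamma -> finite_order gamma ->
  exists psi psi_inv : P2 (complex R) -> P2 (complex R),
    [/\ is_automorphism psi, cancel psi psi_inv, cancel psi_inv psi &
        exists theta_u theta_v : R,
          gamma = psi \o rotation theta_u theta_v \o psi_inv].
Proof.
move=> [A [Au ->]] [n n0].
have [u ->] := iter_proj_map Au n.
(* Reading [id] as the map of the identity matrix turns finite order into the matrix equation A^n =
   c I. *)
rewrite -(proj_map1 (unitmx1 _ _)) => /esym/proj_map_eqP[c c0].
rewrite scalemx1 => An.
have nC : n%:R != 0 :> complex R by rewrite pnatr_eq0 -lt0n.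
have [P [d [Pu AE dn]]] := diagonalizable_expr_scalar nC c0 An.
have d_neq0 i : d 0 i != 0.
  by apply: contraNneq c0 => di0; rewrite -(dn i) di0 expr0n gtn_eqF.
have ratio i : exists t, d 0 i / d 0 2 = expi t.
  by apply: (unity_root_expi n0); rewrite expr_div_n !dn divff.
have [[tu tuE] [tv tvE]] := (ratio 0, ratio 1).
have Qu : invmx P \in unitmx by rewrite unitmx_inv.
have [PK QK] := proj_map_invK Pu Qu.
(* Since A = P^-1 D P, the coordinate change is induced by P^-1. *)
exists (proj_map Qu), (proj_map Pu); split => //; first by exists (invmx P), Qu.
exists tu, tv; rewrite /rotation !proj_map_comp.
(* Dividing D by its last entry makes that entry 1, so the conjugated rotation matrix is [A] scaled
   by [(d 0 2)^-1]. *)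
apply/proj_map_eqP; exists (d 0 2)^-1; first by rewrite invr_eq0.
rewrite AE scalemxAl scalemxAr; congr (_ *m _ *m _).
apply/matrixP => i j; rewrite !mxE mulrnAr; congr (_ *+ _).
case: i => [[|[|[|//]]]] i3 /=; rewrite -?tuE -?tvE mulrC.
- by congr (_ * d 0 _); apply: val_inj.
- by congr (_ * d 0 _); apply: val_inj.
- by rewrite (_ : Ordinal i3 = 2) ?divff//; apply: val_inj.
Qed.
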